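(* For any $k\in\mathbb{N}^+$, $\theta\in(0,1]$ and $\nu>0$ we have $$M_{1,1}(2k+1,\theta,\nu)\ge 0\quad\Longleftrightarrow\quad\nu\le\nu_L(k,\theta),$$ and $$M_{1,j}(2k+1,\theta,\nu)\ge 0\text{ for each }2\le j\le 2k+1\quad\Longleftrightarrow\quad\nu\ge\nu_R(k,\theta).$$ In particular, $$M_{1,j}(2k+1,\theta,\nu)\ge 0\text{ for each }1\le j\le 2k+1\quad\Longleftrightarrow\quad\nu_R(k,\theta)\le\nu\le\nu_L(k,\theta).$$
   Context: $M(2k+1,\theta,\nu)=(I-\theta\nu L)^{-1}(I+(1-\theta)\nu L)\in\mathbb{R}^{m\times m}$ with $m=2k+1$, where $L\in\mathbb{R}^{m\times m}$ is the circulant matrix with, indices modulo $m$, $L_{i,i+1}=\frac12$, $L_{i,i-1}=-\frac12$, all other entries $0$; $I$ is the identity matrix and $M_{1,j}(2k+1,\theta,\nu)$ is the $(1,j)$ entry. $\mathbb{N}^+$ is the set of positive integers. $y_R(k)$ denotes the unique root in $(0,1)$ of the polynomial $P_{R,k}(y)=y^{4k}+y^{2k+1}+y^{2k-1}-1$. For $0<\theta<\frac{2k}{2k+1}$, $y_L(k,\theta)$ denotes the unique root in $(0,1)$ of the polynomial $P_{L,k,\theta}(y)=-\theta y^{4k+4}-(\theta-2)y^{4k+2}+(\theta-2)y^2+\theta$. Define, for $\theta\in(0,1]$, $\nu_R(k,\theta):=\frac{2y_R(k)}{1-y_R(k)^2}\cdot\frac1\theta$, and $\nu_L(k,\theta):=\frac{2y_L(k,\theta)}{1-y_L(k,\theta)^2}\cdot\frac1\theta$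 for $0<\theta<\frac{2k}{2k+1}$, while $\nu_L(k,\theta):=+\infty$ for $\frac{2k}{2k+1}\le\theta\le 1$. *)

(* Defs.v *)
From mathcomp Require Import all_boot all_order all_algebra.
From mathcomp Require Import boolp classical_sets reals ereal.

Set Implicit Arguments.
Unset Strict Implicit.
Unset Printing Implicit Defensive.

Import Order.TTheory GRing.Theory Num.Theory.

Local Open Scope ring_scope.
Local Open Scope classical_set_scope.

(* [ordS] and [ord_pred] are successor and predecessor modulo [m]; they are
   distinct for [2 < m], so the order of the tests below is irrelevant. *)
Definition circL (R : realType) (m : nat) : 'M[R]_m :=
  \matrix_(i < m, j < m)
    (if j == ordS i then 1 / 2 else if j == ord_pred i then - (1 / 2) else 0).

(* [circL R m] is skew-symmetric for [2 < m], hence [1%:M - (theta * nu) *: L]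
   is invertible and [invmx] is a genuine inverse. *)
Definition thetaM (R : realType) (m : nat) (theta nu : R) : 'M[R]_m :=
  invmx (1%:M - (theta * nu) *: circL R m)
    *m (1%:M + ((1 - theta) * nu) *: circL R m).

Definition P_R (R : realType) (k : nat) : {poly R} :=
  'X^(4 * k) + 'X^(2 * k + 1) + 'X^(2 * k - 1) - 1.

Definition P_L (R : realType) (k : nat) (theta : R) : {poly R} :=
  - theta *: 'X^(4 * k + 4) - (theta - 2) *: 'X^(4 * k + 2)
  + (theta - 2) *: 'X^2 + theta%:P.

(* [xget 0 A] is an element of [A] if there is one, and the dummy value [0]
   otherwise.  For [0 < k] the polynomial [P_R R k] has exactly one root in
   ]0, 1[, and so has [P_L k theta] when [0 < theta < 2k / (2k + 1)]; [y_L] is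
   only used for such [theta]. *)
Definition y_R (R : realType) (k : nat) : R :=
  xget 0 [set y : R | 0 < y < 1 /\ root (P_R R k) y].

Definition y_L (R : realType) (k : nat) (theta : R) : R :=
  xget 0 [set y : R | 0 < y < 1 /\ root (P_L k theta) y].

Definition nu_R (R : realType) (k : nat) (theta : R) : R :=
  2 * y_R R k / (1 - y_R R k ^+ 2) * (1 / theta).

Definition nu_L (R : realType) (k : nat) (theta : R) : \bar R :=
  if theta < (2 * k)%:R / (2 * k + 1)%:R then
    (2 * y_L k theta / (1 - y_L k theta ^+ 2) * (1 / theta))%:E
  else +oo%E.

(* Main.v *)
Require Import Defs.
From mathcomp Require Import all_boot all_order all_algebra.
From mathcomp Require Import boolp classical_sets reals ereal.
From mathcomp Require Import ring lra zify.

Set Implicit Arguments.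
Unset Strict Implicit.
Unset Printing Implicit Defensive.

Import Order.TTheory GRing.Theory Num.Theory.

Local Open Scope ring_scope.

(** Write [m = 2k + 1], let [S] be the cyclic shift, [T = S^-1] its inverse, so
    that [L = (S - T) / 2], and substitute [theta * nu = 2y / (1 - y^2)] with
    [0 < y < 1].  This substitution is an increasing bijection onto the positive
    reals ([tan_param_exists], [tan_param_le]) and it factors the matrix to be
    inverted:
      [(1 - y^2) (1 - theta nu L) = (1 - y S) (1 + y T)].
    As [S^m = T^m = 1] with [m] odd, the two factors are inverted by finite
    geometric sums, and partial fractions give the inverse explicitly as a
    polynomial in [S] whose coefficients are [resolvent_coef]
    ([resolvent_mul]).  Since [1 + (1 - theta) nu L] is a combination of [1] and
    [1 - theta nu L], the matrix [M] is [theta^-1] times that inverse minus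
    [(1 - theta) / theta] times the identity ([thetaM_row]).  Hence:

    - The off-diagonal signs do not depend on [theta].  Odd positions are
      always nonnegative.  Among the even ones, the last is the first to become
      negative as [y] decreases, and its sign is that of [P_R] at [y]
      ([offdiag_ge0]).  As [P_R] increases on the nonnegative reals, the
      condition is [y_R <= y].

    - The diagonal entry has the sign of [P_L] at [y] ([diag_ge0]), and
      [P_L = (1 - x) f(x)] with [x = y^2], where [f] is [diag_factor], a
      combination of the reciprocal pairs [x^i + x^(m-i)].  Each quotient
      [(x^i + x^(m-i)) / (1 + x^m)] increases on [0, 1], so that [f], once it is
      [<= 0], is negative from there on ([diag_factor_crossing]).  As
      [f(0) = theta > 0], there is a root in ]0, 1[ exactly when [f(1) < 0],
      which is the condition [theta < 2k / (2k + 1)]; otherwise [f > 0] on the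
      whole interval. *)

(** * The resolvent of the circulant matrix *)

Definition shiftmx (R : realType) (m : nat) : 'M[R]_m :=
  \matrix_(i < m, j < m) (j == ordS i)%:R.

Lemma shiftmx_exp (R : realType) (n p : nat) (i j : 'I_n.+1) :
  (shiftmx R n.+1 ^+ p) i j = (j == (i + p) %% n.+1 :> nat)%N%:R.
Proof.
elim: p j => [|p IHp] j.
  by rewrite expr0 mxE addn0 modn_small // eq_sym.
rewrite exprSr mxE (bigD1 (inord ((i + p) %% n.+1))) //=.
rewrite big1 => [|l l_neq].
  rewrite IHp inordK ?ltn_pmod // eqxx mul1r addr0 mxE -val_eqE /=.
  by rewrite inordK ?ltn_pmod // -(addn1 (_ %% _)) modnDml addn1 addnS.
rewrite IHp; case: eqP => [l_eq|_]; last by rewrite mul0r.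
by rewrite -l_eq inord_val eqxx in l_neq.
Qed.

Lemma shiftmx_order (R : realType) (n : nat) : shiftmx R n.+1 ^+ n.+1 = 1.
Proof.
apply/matrixP => i j.
by rewrite shiftmx_exp modnDr modn_small // mxE eq_sym.
Qed.

(** The exponent [n] plays the role of [-1], since the shift has order [n.+1].
    The hypothesis makes the successor and predecessor modulo [n.+1] distinct;
    otherwise the two nonzero entries of a row would collide. *)
Lemma circL_shiftmx (R : realType) (n : nat) : (1 < n)%N ->
  circL R n.+1 = 2^-1 *: (shiftmx R n.+1 - shiftmx R n.+1 ^+ n).
Proof.
move=> n_gt1; apply/matrixP => i j.
rewrite !mxE shiftmx_exp -!val_eqE /= addnS /=.
have neqSP : (i.+1 %% n.+1)%N != ((i + n) %% n.+1)%N.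
  rewrite -(addn1 i) eqn_modDl !modn_small //; last by rewrite ltnS ltnW.
  by rewrite neq_ltn n_gt1.
case: eqP => [->|_]; last by case: eqP => _; rewrite /=; field.
by rewrite (negbTE neqSP) /=; field.
Qed.

(** This comes from the partial fraction expansion
      [(1 + y^2) / ((1 - y S) (1 + y T)) = 1 / (1 - y S) - y T / (1 + y T)],
    in which [T^(n + 1 - j) = S^j] turns the second geometric sum into powers of
    [S]. *)
Definition resolvent_coef (R : realType) (n : nat) (y : R) (j : nat) : R :=
  (1 - y ^+ 2) / (1 + y ^+ 2)
  * (y ^+ j / (1 - y ^+ n.+1) - y * (- y) ^+ (n - j) / (1 + y ^+ n.+1)).

(** With [A] and [B] the geometric sums of [y S] and [- y T], the factor
    [1 - y S] times [A] and the factor [1 + y T] times [B] are scalar.  Oddness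
    of [n.+1] enters in the second, through [(- y)^(n + 1) = - y^(n + 1)]. *)
Lemma resolvent_mul (R : realType) (n : nat) (y : R) :
    (1 < n)%N -> ~~ odd n -> 0 < y < 1 ->
  (1%:M - (2 * y / (1 - y ^+ 2)) *: circL R n.+1)
    *m (\sum_(l < n.+1) resolvent_coef n y l *: shiftmx R n.+1 ^+ l) = 1%:M.
Proof.
move=> n_gt1 n_even /andP[y_gt0 y_lt1].
set S := shiftmx R n.+1; pose T := S ^+ n.
have ST : S * T = 1 by rewrite -exprS shiftmx_order.
have TS : T * S = 1 by rewrite -exprSr shiftmx_order.
have y2 : 1 - y ^+ 2 != 0 by nra.
have y2' : 1 + y ^+ 2 != 0 by nra.
have yn : y ^+ n.+1 < 1 by rewrite exprn_ilt1 ?ltW.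
have yn0 : 0 < y ^+ n.+1 by rewrite exprn_gt0.
have ym : 1 - y ^+ n.+1 != 0 by lra.
have yp : 1 + y ^+ n.+1 != 0 by lra.
pose A := \sum_(l < n.+1) (y *: S) ^+ l.
pose B := \sum_(l < n.+1) ((- y) *: T) ^+ l.
have T_order : T ^+ n.+1 = 1.
  by rewrite /T -exprM mulnC exprM shiftmx_order expr1n.
have EA : (1 - y *: S) * A = (1 - y ^+ n.+1) *: 1.
  have := subrX1 (y *: S) n.+1; rewrite exprZn shiftmx_order -/A => e.
  by rewrite -opprB mulNr -e opprB scalerBl scale1r.
have EB : (1 + y *: T) * B = (1 + y ^+ n.+1) *: 1.
  have := subrX1 ((- y) *: T) n.+1; rewrite exprZn T_order -/B => e.
  have -> : 1 + y *: T = - ((- y) *: T - 1) by rewrite opprB scaleNr opprK.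
  rewrite mulNr -e opprB exprNn -signr_odd /= n_even expr1 mulN1r.
  by rewrite scaleNr opprK scalerDl scale1r.
(* Partial fractions; reversing the second sum lines up the powers of [S]. *)
have -> : \sum_(l < n.+1) resolvent_coef n y l *: S ^+ l =
    ((1 - y ^+ 2) / (1 + y ^+ 2)) *:
     ((1 - y ^+ n.+1)^-1 *: A - (y / (1 + y ^+ n.+1)) *: (T * B)).
  rewrite /A /B mulr_sumr [X in _ - _ *: X](reindex_inj rev_ord_inj) /=.
  rewrite !scaler_sumr -sumrB scaler_sumr; apply: eq_bigr => l _.
  have -> : T * ((- y) *: T) ^+ (n.+1 - l.+1) = (- y) ^+ (n - l) *: S ^+ l.
    rewrite subSS exprZn -scalerAr; congr (_ *: _).
    have le_ln : (l <= n)%N by rewrite -ltnS.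
    rewrite -exprS -[LHS]mul1r -[in LHS](expr1n _ l) -ST exprMn_comm; last first.
      by rewrite /GRing.comm ST TS.
    by rewrite -mulrA -exprD addnS subnKC // T_order mulr1.
  rewrite exprZn !scalerA -scalerBl scalerA; congr (_ *: _).
  by rewrite /resolvent_coef; field; rewrite ?y2' ?ym ?yp.
(* The factorization: the cross term is [- y^2 S T = - y^2]. *)
have -> : 1%:M - (2 * y / (1 - y ^+ 2)) *: circL R n.+1 =
    (1 - y ^+ 2)^-1 *: ((1 - y *: S) * (1 + y *: T)).
  rewrite circL_shiftmx // -/S -/T mulrDr mulr1 mulrBl mul1r.
  rewrite -scalerAl -scalerAr ST.
  have -> : 1 - y *: S + (y *: T - y *: (y *: 1)) =
     (1 - y ^+ 2) *: 1 - y *: (S - T).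
    rewrite scalerA -expr2 scalerBl scalerBr scale1r -!addrA; congr (_ + _).
    by rewrite opprB !addrA addrC -!addrA; congr (_ + _); rewrite addrC.
  rewrite [RHS]scalerBr !scalerA mulVf // scale1r; congr (_ - _ *: _).
  by field.
have comm : (1 - y *: S) * (1 + y *: T) = (1 + y *: T) * (1 - y *: S).
  rewrite !mulrDl !mulrDr !mulr1 !mul1r !mulrN !mulNr -!scalerAl -!scalerAr.
  rewrite ST TS -!addrA; congr (_ + _).
  by rewrite addrCA.
change (((1 - y ^+ 2)^-1 *: ((1 - y *: S) * (1 + y *: T))) *
   (((1 - y ^+ 2) / (1 + y ^+ 2)) *:
     ((1 - y ^+ n.+1)^-1 *: A - (y / (1 + y ^+ n.+1)) *: (T * B))) = 1).
rewrite -scalerAl -scalerAr scalerA mulrBr -!scalerAr.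
rewrite [X in X * A]comm -(mulrA _ _ A) EA.
have -> : T * B = B * T.
  rewrite mulr_sumr mulr_suml; apply: eq_bigr => l _.
  by rewrite exprZn -scalerAl -scalerAr -exprS exprSr.
rewrite -(mulrA (1 - y *: S)) (mulrA _ B) EB.
rewrite -!scalerAr -!scalerAl mulr1 mul1r -!scalerAr !scalerA mulVf //.
rewrite mulfVK // scale1r [(1 - y *: S) * T]mulrBl mul1r -scalerAl ST.
rewrite [y *: (_ - _)]scalerBr scalerA opprB addrACA subrr addr0.
rewrite -{1}(scale1r (1 : 'M[R]_n.+1)) -scalerDl scalerA.
rewrite -[RHS]scale1r; congr (_ *: _); field.
by rewrite y2 y2'.
Qed.

(** The numerator satisfies
    [1 + (1 - theta) nu L = theta^-1 - ((1 - theta) / theta) (1 - theta nu L)],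
    so it only rescales the resolvent and shifts its diagonal. *)
Lemma thetaM_row (R : realType) (n : nat) (y theta nu : R) (j : 'I_n.+1) :
    (1 < n)%N -> ~~ odd n -> 0 < y < 1 -> 0 < theta ->
    theta * nu = 2 * y / (1 - y ^+ 2) ->
  thetaM n.+1 theta nu ord0 j =
    (resolvent_coef n y j - (1 - theta) * (j == ord0)%:R) / theta.
Proof.
move=> n_gt1 n_even y01 theta_gt0 nuE.
have GV := resolvent_mul n_gt1 n_even y01; rewrite -nuE in GV.
move: GV; set N := 1%:M - _; set G := \sum_(_ < _) _ => GV.
have [uN _] := mulmx1_unit GV.
have invN : invmx N = G by rewrite -[LHS]mulmx1 -GV mulKmx.
have theta0 : theta != 0 by rewrite gt_eqF.
have -> : thetaM n.+1 theta nu = theta^-1 *: G - ((1 - theta) / theta) *: 1%:M.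
  rewrite /thetaM -/N.
  have -> : 1%:M + ((1 - theta) * nu) *: circL R n.+1 =
      theta^-1 *: 1%:M - ((1 - theta) / theta) *: N.
    rewrite /N scalerBr scalerA opprB addrCA addrC -scalerBl.
    congr (_ + _); last by congr (_ *: _); field.
    by rewrite -[LHS]scale1r; congr (_ *: _); field.
  by rewrite mulmxBr -!scalemxAr mulmx1 mulVmx // invN.
rewrite !mxE.
have -> : G ord0 j = resolvent_coef n y j.
  rewrite /G summxE (bigD1 j) //= big1 => [|l l_neq].
    by rewrite addr0 !mxE shiftmx_exp add0n modn_small // eqxx mulr1.
  by rewrite mxE shiftmx_exp add0n modn_small // val_eqE eq_sym (negbTE l_neq) mulr0.
by rewrite [ord0 == j]eq_sym; field.
Qed.

(** * The substitution by a double-angle tangent *)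

Lemma tan_param_exists (R : realType) (a : R) : 0 < a ->
  exists2 y : R, 0 < y < 1 & a = 2 * y / (1 - y ^+ 2).
Proof.
move=> a_gt0.
have [] := @poly_ivt R (2 *: 'X - a *: (1 - 'X^2)) 0 1 ler01.
  by rewrite !hornerE /=; apply/andP; split; lra.
move=> y /andP[y_ge0 y_le1]; rewrite rootE !hornerE /= => /eqP y_root.
have y0 : y != 0 by apply/eqP => y0; move: y_root; rewrite y0; nra.
have y1 : y != 1 by apply/eqP => y1; move: y_root; rewrite y1; nra.
have y01 : 0 < y < 1 by rewrite !lt_def y0 y_ge0 eq_sym y1 y_le1.
exists y => //; case/andP: y01 => y_gt0 y_lt1.
have y2 : 1 - y ^+ 2 != 0 by nra.
by apply: (mulIf y2); rewrite mulfVK //; lra.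
Qed.

Lemma tan_param_le (R : realType) (y z : R) : 0 < y < 1 -> 0 < z < 1 ->
  (2 * y / (1 - y ^+ 2) <= 2 * z / (1 - z ^+ 2)) = (y <= z).
Proof.
move=> /andP[y_gt0 y_lt1] /andP[z_gt0 z_lt1].
have y2 : 0 < 1 - y ^+ 2 by nra.
have z2 : 0 < 1 - z ^+ 2 by nra.
rewrite ler_pdivrMr // mulrAC ler_pdivlMr //.
have yz : 0 < y * z by rewrite mulr_gt0.
by apply/idP/idP => H; nra.
Qed.

(** * The off-diagonal entries *)

Lemma P_R_horner (R : realType) (k : nat) (y : R) :
  (P_R R k).[y] = y ^+ (4 * k) + y ^+ (2 * k + 1) + y ^+ (2 * k - 1) - 1.
Proof. by rewrite /P_R !hornerE. Qed.

Lemma P_R_increasing (R : realType) (k : nat) (y z : R) : (0 < k)%N ->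
  0 <= y -> y < z -> (P_R R k).[y] < (P_R R k).[z].
Proof.
move=> k_gt0 y_ge0 lt_yz; rewrite !P_R_horner ltrD2r.
by rewrite !ltrD // ltrXn2r //; lia.
Qed.

Lemma y_R_spec (R : realType) (k : nat) : (0 < k)%N ->
  0 < y_R R k < 1 /\ root (P_R R k) (y_R R k).
Proof.
move=> k_gt0; apply: (@xgetPex _ 0 [set y : R | 0 < y < 1 /\ root (P_R R k) y]%classic).
have P0 : (P_R R k).[0] = -1.
  rewrite P_R_horner !expr0n.
  have -> : (4 * k == 0)%N = false by lia.
  have -> : (2 * k + 1 == 0)%N = false by lia.
  have -> : (2 * k - 1 == 0)%N = false by lia.
  by rewrite /=; lra.
have P1 : (P_R R k).[1] = 2 by rewrite P_R_horner !expr1n; lra.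
have [|y /andP[y_ge0 y_le1] y_root] := @poly_ivt R (P_R R k) 0 1 ler01.
  by rewrite P0 P1; apply/andP; split; lra.
exists y; split=> //=; rewrite !lt_def y_ge0 y_le1 !andbT.
apply/andP; split; apply/eqP => y_eq; move: y_root; rewrite rootE.
  by rewrite y_eq P0 => /eqP; lra.
by rewrite -y_eq P1 => /eqP; lra.
Qed.

Lemma P_R_ge0 (R : realType) (k : nat) (y : R) : (0 < k)%N -> 0 < y < 1 ->
  (0 <= (P_R R k).[y]) = (y_R R k <= y).
Proof.
move=> k_gt0 /andP[y_gt0 _].
have [/andP[yR_gt0 _] /eqP yR_root] := y_R_spec R k_gt0.
rewrite -[X in X <= _]yR_root; case: (leP (y_R R k) y) => [le_yRy|lt_yyR].
  move: le_yRy; rewrite le_eqVlt => /predU1P[<-|lt]; first exact: lexx.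
  by rewrite ltW // P_R_increasing // ltW.
by apply/negbTE; rewrite -ltNge P_R_increasing // ltW.
Qed.

(** For even [j > 0] the condition is
    [y^(m - j) (1 - y^m) <= y^j (1 + y^m)], with [m = 2k + 1].  As [j] grows to
    [2k] the right side decreases and the left side increases, so [j = 2k] is
    decisive; there it is [y] times the condition [0 <= P_R(y)]. *)
Lemma offdiag_ge0 (R : realType) (k : nat) (y : R) : (0 < k)%N -> 0 < y < 1 ->
  (forall j : 'I_(2 * k).+1, j != ord0 -> 0 <= resolvent_coef (2 * k) y j)
  <-> 0 <= (P_R R k).[y].
Proof.
move=> k_gt0 y01; have /andP[y_gt0 y_lt1] := y01.
have y_ge0 := ltW y_gt0; have y_le1 := ltW y_lt1.
set m := (2 * k).+1.
have yn : y ^+ m < 1 by rewrite exprn_ilt1.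
have yn0 : 0 < y ^+ m by rewrite exprn_gt0.
have ym : 0 < 1 - y ^+ m by lra.
have yp : 0 < 1 + y ^+ m by lra.
have c_gt0 : 0 < (1 - y ^+ 2) / (1 + y ^+ 2) by apply: divr_gt0; nra.
have coefE j : (0 <= resolvent_coef (2 * k) y j) =
    (y * (- y) ^+ (2 * k - j) * (1 - y ^+ m) <= y ^+ j * (1 + y ^+ m)).
  by rewrite /resolvent_coef pmulr_rge0 // subr_ge0 ler_pdivrMr // mulrAC
    ler_pdivlMr.
have P_RE : (0 <= (P_R R k).[y]) =
    (y * (1 - y ^+ m) <= y ^+ (2 * k) * (1 + y ^+ m)).
  rewrite -[RHS]subr_ge0.
  suff -> : y ^+ (2 * k) * (1 + y ^+ m) - y * (1 - y ^+ m) = y * (P_R R k).[y].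
    by rewrite pmulr_rge0.
  rewrite P_R_horner !mulrBr !mulrDr !mulr1 -exprD -!exprS.
  have -> : (2 * k - 1).+1 = (2 * k)%N by lia.
  have -> : (2 * k + m = (4 * k).+1)%N by lia.
  by rewrite addn1; ring.
rewrite P_RE; split=> [coef_ge0|le_last j j_neq0].
  have last_neq0 : ord_max != ord0 :> 'I_(2 * k).+1 by rewrite -val_eqE /=; lia.
  by have := coef_ge0 _ last_neq0; rewrite coefE /= subnn expr0 mulr1.
rewrite coefE.
have le_j : (j <= 2 * k)%N by rewrite -ltnS.
have j_gt0 : (0 < j)%N by rewrite lt0n.
rewrite exprNn -signr_odd oddB // oddM /=.
have yj : 0 < y ^+ j by rewrite exprn_gt0.
have y2kj : 0 < y ^+ (2 * k - j) by rewrite exprn_gt0.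
case: (odd j) => /=.
  (* Odd [j]: the subtracted term is itself nonpositive. *)
  rewrite expr1 mulN1r mulrN mulNr; apply: le_trans (_ : 0 <= _).
    by rewrite oppr_le0 !mulr_ge0 // ltW.
  by rewrite mulr_ge0 ?ltW.
rewrite expr0 mul1r.
apply: (@le_trans _ _ (y * (1 - y ^+ m))).
  by rewrite ler_pM2r // -[X in _ <= X]mulr1 ler_pM2l // exprn_ile1.
apply: le_trans le_last _.
by rewrite ler_pM2r // ler_wiXn2l.
Qed.

(** * The diagonal entry *)

(** This is the cofactor of [1 - x] in [P_L], seen as a polynomial in [x = y^2].
    Its middle coefficients are all [- 2 (1 - theta)]; they are written as a sum
    over the pairs [x^i + x^(m-i)], each term occurring twice, because it is
    these pairs that compare monotonically to [1 + x^m], where [m = 2k + 1]. *)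
Definition diag_factor (R : realType) (k : nat) (theta x : R) : R :=
  theta * (1 + x ^+ (2 * k).+1)
  - (1 - theta) * \sum_(i < 2 * k) (x ^+ i.+1 + x ^+ (2 * k - i)).

Lemma P_L_horner (R : realType) (k : nat) (theta y : R) :
  (P_L k theta).[y] = - theta * y ^+ (4 * k + 4) - (theta - 2) * y ^+ (4 * k + 2)
    + (theta - 2) * y ^+ 2 + theta.
Proof. by rewrite /P_L !hornerE /= -mulrA -expr2. Qed.

Lemma P_L_factor (R : realType) (k : nat) (theta y : R) :
  (P_L k theta).[y] = (1 - y ^+ 2) * diag_factor k theta (y ^+ 2).
Proof.
rewrite P_L_horner /diag_factor; set x := y ^+ 2.
have -> : y ^+ (4 * k + 4) = x * x ^+ (2 * k).+1.
  by rewrite /x -exprS -exprM; congr (_ ^+ _); lia.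
have -> : y ^+ (4 * k + 2) = x ^+ (2 * k).+1.
  by rewrite /x -exprM; congr (_ ^+ _); lia.
have geo : (1 - x) * \sum_(i < 2 * k) x ^+ i = 1 - x ^+ (2 * k).
  by rewrite -opprB mulNr -subrX1 opprB.
rewrite big_split /= [\sum_(i < _) x ^+ (2 * k - i)](reindex_inj rev_ord_inj) /=.
have -> : \sum_(i < 2 * k) x ^+ (2 * k - (2 * k - i.+1)) =
    x * \sum_(i < 2 * k) x ^+ i.
  by rewrite mulr_sumr; apply: eq_bigr => i _; rewrite -exprS subKn.
have -> : \sum_(i < 2 * k) x ^+ i.+1 = x * \sum_(i < 2 * k) x ^+ i.
  by rewrite mulr_sumr; apply: eq_bigr => i _; rewrite exprS.
rewrite exprS; move: (x ^+ (2 * k)) geo => z geo.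
set s := \sum_(i < _) _ in geo *.
have -> : (1 - x) * (theta * (1 + x * z) - (1 - theta) * (x * s + x * s)) =
   (1 - x) * (theta * (1 + x * z)) - 2 * (1 - theta) * x * ((1 - x) * s) by ring.
by rewrite geo; ring.
Qed.

(** With [m = 2k + 1], at index [0] the difference of the two terms of the
    coefficient collapses to
    [(1 - y^2) (1 + y^(2m)) / ((1 + y^2) (1 - y^(2m)))]; clearing this positive
    denominator leaves exactly [P_L]. *)
Lemma diag_ge0 (R : realType) (k : nat) (theta y : R) : 0 < y < 1 ->
  (0 <= resolvent_coef (2 * k) y 0 - (1 - theta)) = (0 <= (P_L k theta).[y]).
Proof.
move=> /andP[y_gt0 y_lt1].
have y_ge0 := ltW y_gt0.
have yn : y ^+ (2 * k).+1 < 1 by rewrite exprn_ilt1.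
have yn0 : 0 < y ^+ (2 * k).+1 by rewrite exprn_gt0.
have d_gt0 : 0 < (1 + y ^+ 2) * (1 - y ^+ (2 * k).+1 ^+ 2).
  by apply: mulr_gt0; nra.
rewrite /resolvent_coef expr0 subn0 exprNn -signr_odd oddM /= expr0 !mul1r -exprS.
rewrite -(pmulr_rge0 _ d_gt0); congr (0 <= _).
rewrite P_L_horner.
have -> : y ^+ (4 * k + 4) = y ^+ 2 * y ^+ (2 * k).+1 ^+ 2.
  by rewrite -exprM -exprD; congr (_ ^+ _); lia.
have -> : y ^+ (4 * k + 2) = y ^+ (2 * k).+1 ^+ 2.
  by rewrite -exprM; congr (_ ^+ _); lia.
by field; rewrite !(gt_eqF, lt0r_neq0) //; nra.
Qed.

(** This is the strict monotonicity of [(a + b) / (1 + a b)] on the unit square: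
    it is the addition law of the hyperbolic tangent, increasing in each
    variable. *)
Lemma reciprocal_pair_lt (R : realType) (a b c d : R) :
    0 <= a < c -> 0 <= b < d -> c <= 1 -> d <= 1 ->
  (a + b) * (1 + c * d) < (c + d) * (1 + a * b).
Proof.
move=> /andP[a_ge0 lt_ac] /andP[b_ge0 lt_bd] c_le1 d_le1.
have -> : (a + b) * (1 + c * d) = (c + d) * (1 + a * b)
    - ((c - a) * (1 - b * d) + (d - b) * (1 - a * c)) by ring.
have bd : b * d < 1 by nra.
have ac : a * c < 1 by nra.
have : 0 < (c - a) * (1 - b * d) by apply: mulr_gt0; lra.
have : 0 < (d - b) * (1 - a * c) by apply: mulr_gt0; lra.
lra.
Qed.

(** Dividing by [1 + x^m] turns the sign of the factor into a comparison of
    [theta] with [1 - theta] times a sum of reciprocal quotients increasing in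
    [x], so the sign can only change from positive to negative.  When
    [theta = 1] the sum disappears and the factor is plainly positive. *)
Lemma diag_factor_crossing (R : realType) (k : nat) (theta x z : R) :
    (0 < k)%N -> 0 < theta <= 1 -> 0 <= x -> x < z -> z <= 1 ->
  0 <= diag_factor k theta z -> 0 < diag_factor k theta x.
Proof.
move=> k_gt0 /andP[theta_gt0 theta_le1] x_ge0 lt_xz z_le1.
have z_ge0 : 0 <= z by rewrite (le_trans x_ge0) // ltW.
have xm : 0 <= x ^+ (2 * k).+1 by rewrite exprn_ge0.
have zm : 0 <= z ^+ (2 * k).+1 by rewrite exprn_ge0.
rewrite /diag_factor.
set X := \sum_(i < 2 * k) (x ^+ _ + _); set Z := \sum_(i < 2 * k) (z ^+ _ + _).
have ltXZ : X * (1 + z ^+ (2 * k).+1) < Z * (1 + x ^+ (2 * k).+1).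
  rewrite !mulr_suml; apply: ltr_sum => [|i _].
    have k2_gt0 : (0 < 2 * k)%N by lia.
    by apply/hasP; exists (Ordinal k2_gt0); rewrite ?mem_index_enum.
  have expE (u : R) : u ^+ (2 * k).+1 = u ^+ i.+1 * u ^+ (2 * k - i).
    by rewrite -exprD addSn subnKC // ltnW.
  have i_neq : (2 * k - i != 0)%N by rewrite subn_eq0 -ltnNge.
  rewrite !expE; apply: reciprocal_pair_lt; rewrite ?exprn_ile1 //.
    by rewrite exprn_ge0 // ltrXn2r.
  by rewrite exprn_ge0 // ltrXn2r.
have [->|theta_neq1] := eqVneq theta 1; first by nra.
move: xm zm ltXZ; set a := x ^+ _; set c := z ^+ _ => xm zm ltXZ fz.
have theta1 : 0 < 1 - theta by rewrite subr_gt0 lt_def eq_sym theta_neq1.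
have h1 : (1 - theta) * (X * (1 + c)) < (1 - theta) * (Z * (1 + a)).
  by rewrite ltr_pM2l.
have h2 : 0 <= (theta * (1 + c) - (1 - theta) * Z) * (1 + a).
  by rewrite mulr_ge0 //; lra.
rewrite -(@pmulr_rgt0 _ (1 + c)); [lra|lra].
Qed.

Lemma diag_factor0 (R : realType) (k : nat) (theta : R) :
  diag_factor k theta 0 = theta.
Proof.
rewrite /diag_factor big1 => [|i _]; first by rewrite expr0n /=; ring.
by rewrite !expr0n /= subn_eq0 leqNgt ltn_ord addr0.
Qed.

Lemma diag_factor1_ge0 (R : realType) (k : nat) (theta : R) :
  (0 <= diag_factor k theta 1) = ((2 * k)%:R / (2 * k + 1)%:R <= theta).
Proof.
rewrite /diag_factor (eq_bigr (fun=> 2)) => [|i _]; last first.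
  by rewrite !expr1n; ring.
rewrite sumr_const card_ord expr1n ler_pdivrMr ?ltr0n ?addn1 //.
rewrite -[X in _ = X]subr_ge0 -[RHS](pmulr_rge0 _ (ltr0Sn R 1)).
by congr (0 <= _); rewrite -[2 *+ _]mulr_natl -natr1; ring.
Qed.

Lemma y_L_spec (R : realType) (k : nat) (theta : R) :
    0 < theta -> theta < (2 * k)%:R / (2 * k + 1)%:R ->
  0 < y_L k theta < 1 /\ root (P_L k theta) (y_L k theta).
Proof.
move=> theta_gt0 theta_lt.
apply: (@xgetPex _ 0 [set y : R | 0 < y < 1 /\ root (P_L k theta) y]%classic).
(* The opposite of the factor: it goes from negative at 0 to positive at 1.
   Using [P_L] itself would not do, since it vanishes at 1. *)
pose p : {poly R} := (1 - theta) *: (\sum_(i < 2 * k) ('X^(i.+1) + 'X^(2 * k - i)))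
  - theta *: (1 + 'X^((2 * k).+1)).
have pE x : p.[x] = - diag_factor k theta x.
  rewrite /p !hornerE horner_sum opprB; congr (_ * _ - _).
  by apply: eq_bigr => i _; rewrite !hornerE.
have p1 : 0 < p.[1] by rewrite pE oppr_gt0 ltNge diag_factor1_ge0 -ltNge.
have p0 : p.[0] < 0 by rewrite pE diag_factor0 oppr_lt0.
have [|x /andP[x_ge0 x_le1] /eqP x_root] := @poly_ivt R p 0 1 ler01.
  by rewrite !ltW.
have x_gt0 : 0 < x.
  by rewrite lt_def x_ge0 andbT; apply/eqP => x0; move: p0; rewrite -[X in p.[X]]x0 x_root ltxx.
have x_lt1 : x < 1.
  by rewrite lt_def x_le1 andbT; apply/eqP => x1; move: p1; rewrite x1 x_root ltxx.
exists (Num.sqrt x); split.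
  by rewrite sqrtr_gt0 x_gt0 -[X in _ < X]sqrtr1 ltr_sqrt.
rewrite rootE P_L_factor sqr_sqrtr //.
by have /eqP := pE x; rewrite x_root eq_sym oppr_eq0 => /eqP ->; rewrite mulr0.
Qed.

Lemma P_L_ge0 (R : realType) (k : nat) (theta y : R) :
    (0 < k)%N -> 0 < theta <= 1 -> 0 < y < 1 ->
  (0 <= (P_L k theta).[y]) =
    (theta < (2 * k)%:R / (2 * k + 1)%:R) ==> (y <= y_L k theta).
Proof.
move=> k_gt0 theta01 /andP[y_gt0 y_lt1].
have crossing := diag_factor_crossing k_gt0 theta01.
rewrite P_L_factor pmulr_rge0; last by nra.
case: ltP => [theta_lt|le_theta] /=; last first.
  by rewrite ltW // (crossing _ 1) ?diag_factor1_ge0 //; nra.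
have [theta_gt0 _] := andP theta01.
have [/andP[yL_gt0 yL_lt1]] := y_L_spec theta_gt0 theta_lt.
rewrite rootE P_L_factor mulf_eq0 gt_eqF /=; last by nra.
move=> /eqP yL_root.
case: (ltgtP y (y_L k theta)) => [lt_y|gt_y|->]; last by rewrite yL_root lexx.
  by rewrite ltW // (crossing _ (y_L k theta ^+ 2)) ?yL_root ?lexx //; nra.
apply/negbTE/negP => fy.
suff : 0 < diag_factor k theta (y_L k theta ^+ 2) by rewrite yL_root ltxx.
by apply: crossing fy; nra.
Qed.

(** * The sign conditions in terms of [nu] *)

(* MathComp world; matrix indices start at 0, so the entry (1, j) of the text
   is the entry (ord0, j - 1) here. *)
Theorem corollary4 (R : realType) (k : nat) (theta nu : R)
    (hk : (0 < k)%N) (htheta0 : 0 < theta) (htheta1 : theta <= 1)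
    (hnu : 0 < nu) :
  [/\ 0 <= thetaM (2 * k).+1 theta nu ord0 ord0
        <-> (nu%:E <= nu_L k theta)%E,
      (forall j : 'I_(2 * k).+1,
          j != ord0 -> 0 <= thetaM (2 * k).+1 theta nu ord0 j)
        <-> nu_R k theta <= nu
    & (forall j : 'I_(2 * k).+1, 0 <= thetaM (2 * k).+1 theta nu ord0 j)
        <-> nu_R k theta <= nu /\ (nu%:E <= nu_L k theta)%E].
Proof.
have [y y01 nuE] := tan_param_exists (mulr_gt0 htheta0 hnu).
have k2_gt1 : (1 < 2 * k)%N by lia.
have k2_even : ~~ odd (2 * k) by rewrite oddM.
have row j := thetaM_row j k2_gt1 k2_even y01 htheta0 nuE.
have diag : 0 <= thetaM (2 * k).+1 theta nu ord0 ord0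
        <-> (nu%:E <= nu_L k theta)%E.
  rewrite row eqxx mulr1 pmulr_lge0 ?invr_gt0 // diag_ge0 // P_L_ge0 ?htheta0 //.
  rewrite /nu_L; case: ifP => [theta_lt|_]; last by rewrite leey.
  rewrite lee_fin mul1r ler_pdivlMr // mulrC nuE tan_param_le //.
  by have [] := y_L_spec htheta0 theta_lt.
have offdiag : (forall j : 'I_(2 * k).+1,
          j != ord0 -> 0 <= thetaM (2 * k).+1 theta nu ord0 j)
        <-> nu_R k theta <= nu.
  rewrite /nu_R mul1r ler_pdivrMr // [nu * _]mulrC nuE tan_param_le //; last first.
    by have [] := y_R_spec R hk.
  rewrite -P_R_ge0 // -offdiag_ge0 //; split=> row_ge0 j j_neq0.
    have := row_ge0 j j_neq0.
    by rewrite row (negbTE j_neq0) mulr0 subr0 pmulr_lge0 ?invr_gt0.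
  by rewrite row (negbTE j_neq0) mulr0 subr0 pmulr_lge0 ?invr_gt0 // row_ge0.
split=> //; rewrite -offdiag -diag; split=> [row_ge0|[off_ge0 diag_ge0] j].
  by split=> [j _|]; apply: row_ge0.
by have [->|/off_ge0] := eqVneq j ord0.
Qed.
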